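(* Let $q$ be a prime power, $n\geq 2$ an integer, and let $W=\{\omega_j:0\leq j\leq n-1\}$ be any (ordered) basis for $\mathbb{F}_{q^n}$ over $\mathbb{F}_q$. Define $\psi_W:\mathrm{PG}(n-1,q)\to \mu_{\frac{q^n-1}{q-1}}$ by $$\psi_W(x_0:\dots:x_{n-1})=\Biggl(\sum_{j=0}^{n-1}x_j\omega_j\Biggr)^{q-1}=\frac{\sum_{j=0}^{n-1}x_j\omega_j^q}{\sum_{j=0}^{n-1}x_j\omega_j}.$$ Then $\psi_W$ is a bijection. Moreover, for $0\leq i\leq n-1$, define $$T_{W,i}(x)=\sum_{k=0}^{n-1}(-1)^{k(n-1)}c_i^{q^k}x^{\frac{q^k-1}{q-1}},$$ in which the constant term $c_i=T_{W,i}(0)$ is the $(i,0)$-cofactor of the matrix $$M_W=\begin{bmatrix}\omega_0&\omega_0^q&\dots&\omega_0^{q^{n-1}}\\ \omega_1&\omega_1^q&\dots&\omega_1^{q^{n-1}}\\ \vdots&\vdots&\ddots&\vdots\\ \omega_{n-1}&\omega_{n-1}^q&\dots&\omega_{n-1}^{q^{n-1}}\end{bmatrix}.$$ Then for each $x\in\mu_{\frac{q^n-1}{q-1}}$, $$\psi_W^{-1}(x)=\begin{cases}(1:0:\dots:0)&\text{if }x=\omega_0^{q-1};\\ \Bigl(\frac{T_{W,0}(x)}{T_{W,1}(x)}:1:0:\dots:0\Bigr)&\text{if }x=(x_0\omega_0+\omega_1)^{q-1}\text{ for some }x_0\in\mathbb{F}_q;\\ \quad\vdots&\quad\vdots\\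 \Bigl(\frac{T_{W,0}(x)}{T_{W,n-1}(x)}:\dots:\frac{T_{W,n-2}(x)}{T_{W,n-1}(x)}:1\Bigr)&\text{if }x=(x_0\omega_0+\dots+x_{n-2}\omega_{n-2}+\omega_{n-1})^{q-1}\text{ for some }x_0,\dots,x_{n-2}\in\mathbb{F}_q.\end{cases}$$ That is, for each $0\leq j\leq n-1$, if $x=(x_0\omega_0+\dots+x_{j-1}\omega_{j-1}+\omega_j)^{q-1}$ for some $x_0,\dots,x_{j-1}\in\mathbb{F}_q$, then $\psi_W^{-1}(x)=\Bigl(\frac{T_{W,0}(x)}{T_{W,j}(x)}:\dots:\frac{T_{W,j-1}(x)}{T_{W,j}(x)}:1:0:\dots:0\Bigr)$.
   Context: $\mathrm{PG}(n-1,q)=(\mathbb{F}_q^n\setminus\{\vec 0\})/\sim$, where $\vec x\sim\vec y$ iff $\vec x=\lambda\vec y$ for some $\lambda\in\mathbb{F}_q^\ast$; the class of $(x_0,\dots,x_{n-1})$ is written $(x_0:\dots:x_{n-1})$. $\mu_\ell\subseteq\mathbb{F}_{q^n}$ is the set of all $\ell$-th roots of unity. Rows and columns of $n\times n$ matrices are indexed by $0,\dots,n-1$; the $(i,0)$-cofactor is $(-1)^i$ times the determinant of the matrix obtained by deleting row $i$ and column $0$. *)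

(* Defs.v *)
From HB Require Import structures.
From mathcomp Require Import all_boot all_order all_algebra all_fingroup all_field.

Set Implicit Arguments.
Unset Strict Implicit.
Unset Printing Implicit Defensive.

Import GRing.Theory.
Local Open Scope ring_scope.

Definition nzvec (F : finFieldType) (n : nat) := {x : 'rV[F]_n | x != 0}.

Section ProjectiveSpace.
Variables (F : finFieldType) (n : nat).

Definition proj_eq (x y : nzvec F n) : bool :=
  [exists l : F, (l != 0) && (val x == l *: val y)].

Lemma proj_eq_refl : reflexive proj_eq.
Proof. by move=> x; apply/existsP; exists 1; rewrite oner_neq0 scale1r /=. Qed.

Lemma proj_eq_sym : symmetric proj_eq.
Proof.
suff H x y : proj_eq x y -> proj_eq y x by move=> x y; apply/idP/idP; apply: H.
move=> /existsP[l /andP[l0 /eqP E]]; apply/existsP; exists l^-1.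
by rewrite invr_neq0 // E scalerA mulVf // scale1r eqxx.
Qed.

Lemma proj_eq_trans : transitive proj_eq.
Proof.
move=> y x z /existsP[l /andP[l0 /eqP E]] /existsP[m /andP[m0 /eqP E']].
by apply/existsP; exists (l * m); rewrite mulf_neq0 // E E' scalerA eqxx.
Qed.

Canonical proj_eq_equiv :=
  EquivRel proj_eq proj_eq_refl proj_eq_sym proj_eq_trans.

(* [PG F n] has n homogeneous coordinates: it is PG(n-1, q) for q = #|F|.     *)
(* The point (x_0 : ... : x_(n-1)) is [\pi_(PG F n)%qT x].                    *)
Definition PG := {eq_quot proj_eq_equiv}%qT.

End ProjectiveSpace.

Definition mu (L : fieldType) (l : nat) := {z : L | l.-unity_root z}.

Section Psi.
Variables (F : finFieldType) (L : fieldExtType F) (n : nat) (W : n.-tuple L).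

Definition lincomb (x : 'rV[F]_n) : L := \sum_(j < n) x 0 j *: tnth W j.

Definition mu_exponent : nat := ((#|F| ^ n - 1) %/ (#|F| - 1))%N.

Hypothesis basisW : basis_of fullv W.

Lemma lincomb_neq0 (x : nzvec F n) : lincomb (val x) != 0.
Proof.
apply: contra (valP x) => /eqP S0; apply/eqP/rowP => i; rewrite mxE.
apply: (freeP (basis_free basisW) (fun j => val x 0 j)).
by rewrite -[RHS]S0; apply: eq_bigr => j _; rewrite (tnth_nth 0).
Qed.

Lemma lincomb_expn_mu (x : nzvec F n) :
  mu_exponent.-unity_root (lincomb (val x) ^+ (#|F| - 1)).
Proof.
have y0 := lincomb_neq0 x; set y := lincomb _ in y0 *.
apply/unity_rootP; rewrite -exprM /mu_exponent mulnC divnK; last first.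
  by rewrite !subn1 dvdn_pred_predX.
pose fL : finFieldType := finvect_type L.
have cL : #|fL| = (#|F| ^ n)%N.
  have -> : n = \dim {:L} by rewrite -(size_basis basisW).
  by rewrite -(@card_vspacef F fL (Vector.class L)) card_vspace.
have : y ^+ #|fL| = y by exact: (@expf_card fL).
rewrite cL => E; apply: (mulfI y0).
by rewrite -exprS mulr1 subn1 prednK // expn_gt0 (cardD1 0).
Qed.

(* [psi] evaluates [psi_vec] at the canonical representative of a point. *)
Definition psi_vec (x : nzvec F n) : mu L mu_exponent :=
  exist _ (lincomb (val x) ^+ (#|F| - 1)) (lincomb_expn_mu x).

Definition psi : PG F n -> mu L mu_exponent := lift_fun1 (PG F n) psi_vec.

End Psi.

Section InversePolynomials.
Variables (F : finFieldType) (L : fieldExtType F) (n : nat) (W : n.-tuple L).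

Definition moore_mx : 'M[L]_n := \matrix_(i, j) tnth W i ^+ (#|F| ^ j).

Variable n_gt0 : (0 < n)%N.

Definition moore_cofactor (i : 'I_n) : L :=
  cofactor moore_mx i (Ordinal n_gt0).

Definition Tpoly (i : 'I_n) : {poly L} :=
  \sum_(k < n) ((-1) ^+ (k * (n - 1)) * moore_cofactor i ^+ (#|F| ^ k))
                 *: 'X^((#|F| ^ k - 1) %/ (#|F| - 1)).

End InversePolynomials.

(* Main.v *)
(* The cofactors c_i, divided by D = det M_W, form the basis dual to W for the
   trace form: cofactor expansion gives sum_i c_i w_i^(q^j) = D [j = 0], and
   applying powers of the Frobenius map, under which
   D^(q^k) = (-1)^(k(n-1)) D, turns this into a left inverse of M_W; read as a
   right inverse, it says sum_k (-1)^(k(n-1)) (c_i w_j)^(q^k) = D [i = j].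
   Hence, for y = sum_j x_j w_j and x = y^(q-1), where
   x^((q^k-1)/(q-1)) = y^(q^k-1), one gets T_{W,i}(x) = (D / y) x_i: the
   vector of the T_{W,i}(x) is proportional to the coordinates of y.
   The map psi_W is injective because y^(q-1) = z^(q-1) makes y / z fixed by
   the Frobenius map, and surjective because L^* is cyclic. *)

Require Import Defs.
From HB Require Import structures.
From mathcomp Require Import all_boot all_order all_algebra all_fingroup all_field.

Set Implicit Arguments.
Unset Strict Implicit.
Unset Printing Implicit Defensive.

Import GRing.Theory.
Local Open Scope ring_scope.

(** * Frobenius powers, roots of unity and linearized polynomials over a finite field *)

Section FiniteExtension.
Variables (F : finFieldType) (L : fieldExtType F).
Local Notation q := #|F|.

Definition frob (k : nat) (x : L) : L := x ^+ (q ^ k).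

(** Since [q] is a power of the characteristic [p], [frob k] is an iterate of the [p]-power map,
    which is additive. *)
Fact frob_is_zmod_morphism k : zmod_morphism (frob k).
Proof.
move=> x y; rewrite /frob; have [p _ pcharFp] := finPcharP F.
rewrite (card_pprimeChar pcharFp) -expnM; elim: (_ * k)%N => // n IHn.
by rewrite expnSr !exprM IHn -(pchar_lalg L) in pcharFp *;
   rewrite -!(pFrobenius_autE pcharFp) rmorphB.
Qed.

Fact frob_is_monoid_morphism k : monoid_morphism (frob k).
Proof. by split=> [|x y]; rewrite /frob ?expr1n ?exprMn. Qed.

HB.instance Definition _ k :=
  GRing.isZmodMorphism.Build L L (frob k) (frob_is_zmod_morphism k).
HB.instance Definition _ k :=
  GRing.isMonoidMorphism.Build L L (frob k) (frob_is_monoid_morphism k).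

Lemma expf_card_exp (a : F) k : a ^+ (q ^ k) = a.
Proof. by elim: k => // k IHk; rewrite expnSr exprM IHk expf_card. Qed.

Lemma frobZ k (a : F) x : frob k (a *: x) = a *: frob k x.
Proof. by rewrite /frob exprZn expf_card_exp. Qed.

Lemma frob_frob j k x : frob j (frob k x) = frob (k + j) x.
Proof. by rewrite /frob -exprM expnD. Qed.

Lemma frob_dim x : frob (\dim {:L}) x = x.
Proof. by apply/eqP; rewrite -[_ == _]Fermat's_little_theorem memvf. Qed.

Lemma frob_fixed x : frob 1 x = x -> exists a : F, x = a *: 1.
Proof.
move=> xq; apply/vlineP; rewrite Fermat's_little_theorem dimv1.
exact/eqP.
Qed.

Lemma expr_card_pred (x : L) : x ^+ q = x ^+ (q - 1) * x.
Proof. by rewrite -exprSr subn1 prednK // (cardD1 0). Qed.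

Lemma expf_card_pred (a : F) : a != 0 -> a ^+ (q - 1) = 1.
Proof.
move=> a0; apply: (mulIf a0).
by rewrite mul1r -exprSr subn1 prednK ?expf_card // (cardD1 0).
Qed.

Lemma card_finvect_type :
  #|(finvect_type L : finFieldType)| = (q ^ \dim {:L})%N.
Proof.
pose fL := finvect_type L : finFieldType.
by rewrite -(@card_vspacef F fL (Vector.class L)) card_vspace.
Qed.

Lemma exists_primitive_root :
  exists z : L, (q ^ \dim {:L} - 1).-primitive_root z.
Proof.
pose fL := finvect_type L : finFieldType; have cL := card_finvect_type.
have cU : size (enum [pred x : fL | x != 0]) = (q ^ \dim {:L} - 1)%N.
  rewrite -cardE -cL (cardD1 (0 : fL) fL) /= add1n subn1.
  by apply: eq_card => x; rewrite !inE andbT.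
suff /hasP[z _ pz] : has (q ^ \dim {:L} - 1).-primitive_root
    (enum [pred x : fL | x != 0]) by exists z.
(* With [N = q ^ \dim {:L} - 1], the nonzero elements are [N] distinct [N]-th roots of unity, which
   forces a primitive one among them. *)
apply: cyclic.has_prim_root; rewrite ?enum_uniq ?cU //.
  by rewrite subn_gt0 -(exp1n (\dim {:L})) ltn_exp2r ?finNzRing_gt1 ?adim_gt0.
apply/allP=> x; rewrite mem_enum inE => x0; apply/unity_rootP.
apply: (mulIf x0); rewrite -exprSr subn1 prednK -cL ?expf_card ?mul1r //.
by rewrite (cardD1 0).
Qed.

(** For [z = g ^+ i] with [g] a generator of the multiplicative group, the order of [g] is [q - 1]
    times the exponent of [z], so [q - 1] divides [i]. *)
Lemma unity_root_expn_card_pred (z : L) :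
  (mu_exponent F (\dim {:L})).-unity_root z ->
  exists2 y : L, y != 0 & z = y ^+ (q - 1).
Proof.
rewrite unity_rootE /mu_exponent => /eqP z1.
have q1 : (0 < q - 1)%N by rewrite subn_gt0 finNzRing_gt1.
have dvq : (q - 1 %| q ^ \dim {:L} - 1)%N by rewrite !subn1 dvdn_pred_predX.
have [g pg] := exists_primitive_root; have N0 := prim_order_gt0 pg.
have zN : z ^+ (q ^ \dim {:L} - 1) = 1.
  by rewrite -(divnK dvq) exprM z1 expr1n.
have [i zi] := prim_rootP pg zN.
have : (q - 1 %| i)%N.
  move/eqP: z1; rewrite zi -exprM -(prim_order_dvd pg).
  rewrite -{1}(divnK dvq) mulnC dvdn_pmul2r //.
  by rewrite divn_gt0 // dvdn_leq.
case/dvdnP=> m im; exists (g ^+ m); last by rewrite zi im exprM.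
rewrite expf_neq0 //; apply/eqP=> g0; have := prim_expr_order pg.
by move/eqP; rewrite g0 expr0n eqn0Ngt N0 eq_sym oner_eq0.
Qed.

(** The associated polynomial has degree at most [q ^ (n - 1)], less than the number of elements of
    [L], all of which are roots. Its exponents [q ^ j] are distinct, so its vanishing kills every
    [a 0 j]. *)
Lemma linearized_poly_eq0 n (a : 'rV[L]_n) : (n <= \dim {:L})%N ->
  (forall y, \sum_(j < n) a 0 j * frob j y = 0) -> a = 0.
Proof.
move=> le_n_d a_vanish; pose p : {poly L} := \sum_(j < n) a 0 j *: 'X^(q ^ j).
have q1 := finNzRing_gt1 F.
have coef_p i : p`_i = \sum_(j < n) a 0 j * (i == q ^ j)%N%:R.
  by rewrite coef_sum; apply: eq_bigr => j _; rewrite coefZ coefXn.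
suff p0 : p = 0.
  apply/rowP=> j; rewrite mxE.
  have := coef_p (q ^ j)%N; rewrite p0 coef0 (bigD1 j) //= eqxx mulr1.
  rewrite big1 ?addr0 // => k; rewrite eqn_exp2l // eq_sym => /negPf njk.
  by rewrite val_eqE njk mulr0.
apply/eqP; apply: contraT => p_neq0.
pose fL := finvect_type L : finFieldType; have cL := card_finvect_type.
have sz_enum : size (enum fL) = (q ^ \dim {:L})%N by rewrite -cardE.
have all_roots : all (root p) (enum fL).
  apply/allP=> y _; rewrite rootE horner_sum -[X in _ == X](a_vanish y).
  by apply/eqP; apply: eq_bigr => j _; rewrite hornerZ hornerXn.
have := max_poly_roots p_neq0 all_roots (enum_uniq _).
rewrite sz_enum ltnNge => /negP[]; apply/leq_sizeP=> i le_i.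
rewrite coef_p big1 // => j _; rewrite gtn_eqF ?mulr0 //.
by apply: leq_trans le_i; rewrite ltn_exp2l // (leq_trans _ le_n_d).
Qed.
End FiniteExtension.

(** * The Moore matrix, its cofactors and the values of the polynomials [Tpoly] *)

Section Moore.
Variables (F : finFieldType) (L : fieldExtType F) (n : nat) (W : n.-tuple L).
Hypothesis dimL : \dim {:L} = n.
Hypothesis basisW : basis_of fullv W.
Local Notation q := #|F|.
Local Notation M := (moore_mx W).

Lemma lincombP (y : L) : exists x : 'rV[F]_n, y = lincomb W x.
Proof.
exists (\row_i coord W i y); rewrite /lincomb {1}(coord_basis basisW (memvf y)).
by apply: eq_bigr => j _; rewrite mxE (tnth_nth 0).
Qed.

Lemma frob_lincomb k x :
  frob k (lincomb W x) = \sum_(j < n) x 0 j *: frob k (tnth W j).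
Proof. by rewrite rmorph_sum; apply: eq_bigr => j _; rewrite /= frobZ. Qed.

Lemma lincombZ (l : F) x : lincomb W (l *: x) = l *: lincomb W x.
Proof. by rewrite scaler_sumr; apply: eq_bigr => j _; rewrite mxE scalerA. Qed.

Lemma lincomb_inj : injective (lincomb W).
Proof.
move=> x y exy; apply/rowP=> j; apply/eqP; rewrite -subr_eq0; apply/eqP.
move: j; apply: (freeP (basis_free basisW)).
rewrite (eq_bigr (fun i => x 0 i *: tnth W i - y 0 i *: tnth W i)) => [|i _].
  by rewrite sumrB; apply/eqP; rewrite subr_eq0; apply/eqP.
by rewrite scalerBl (tnth_nth 0).
Qed.

(** A linear relation between the columns of [M] is a linearized polynomial vanishing on the basis
    [W], hence by [F]-linearity on all of [L]. *)
Lemma moore_det_neq0 : \det M != 0.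
Proof.
rewrite -det_tr -unitfE -[_ \is a _]/(M^T \in unitmx) -row_free_unit.
apply: inj_row_free => a aM0; apply: linearized_poly_eq0 => [|y].
  by rewrite dimL.
have [x ->] := lincombP y.
under eq_bigr => j _ do rewrite frob_lincomb mulr_sumr.
rewrite exchange_big big1 //= => i _.
under eq_bigr => j _ do rewrite -scalerAr.
rewrite -scaler_sumr.
have := congr1 (fun A : 'rV_n => A 0 i) aM0; rewrite !mxE => aM0i.
rewrite (eq_bigr (fun j => a 0 j * (M^T) j i)) ?aM0i ?scaler0 // => j _.
by rewrite !mxE.
Qed.

(* The Frobenius map cyclically shifts the columns of [M]. *)
Lemma frob_moore_det : frob 1 (\det M) = (-1) ^+ (n - 1) * \det M.
Proof.
case: n W dimL => [|m] V dimV; first by rewrite !det_mx00 rmorph1 mulr1.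
set N := moore_mx V.
have frob_n (x : L) : frob m.+1 x = x by rewrite -[RHS]frob_dim dimV.
(* [s] sends column 0 to the last one and column [k + 1] to column [k]; this cycle has the parity of
   [m], whence the sign. *)
pose s : 'S_m.+1 := lift_perm ord0 ord_max 1%g.
have frobN : N = col_perm s (map_mx (frob 1) N).
  apply/matrixP=> i j; rewrite !mxE; case: (unliftP ord0 j) => [k|] ->.
    by rewrite lift_perm_lift perm1 lift_max -/(frob _ _) frob_frob addn1.
  by rewrite lift_perm_id /= -/(frob m _) frob_frob addn1 frob_n.
rewrite {2}frobN col_permE det_mulmx det_map_mx det_perm odd_permV.
rewrite odd_lift_perm odd_perm1 addbF /= subn1 /=.
by rewrite mulrCA signr_odd -expr2 sqrr_sign mulr1.
Qed.

Lemma frob_exp_moore_det k :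
  frob k (\det M) = (-1) ^+ (k * (n - 1)) * \det M.
Proof.
elim: k => [|k IHk]; first by rewrite /frob expn0 expr1 mul1r.
rewrite -addn1 -frob_frob IHk rmorphM rmorphXn rmorphN1 /= frob_moore_det.
by rewrite mulrA -exprD addn1 mulSn addnC.
Qed.

Variable n_gt0 : (0 < n)%N.
Local Notation c := (moore_cofactor W n_gt0).

(** The cofactors of column 0 form row 0 of the adjugate of [M]. *)
Lemma sum_moore_cofactor (m : 'I_n) :
  \sum_(i < n) c i * frob m (tnth W i) = \det M *+ (m == 0 :> nat).
Proof.
have := congr1 (fun A : 'M_n => A (Ordinal n_gt0) m) (mul_adj_mx M).
rewrite !mxE eq_sym -val_eqE /= => <-.
by apply: eq_bigr => i _; rewrite !mxE.
Qed.

Lemma sum_frob_moore_cofactor (k j : 'I_n) :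
  \sum_(i < n) (-1) ^+ (k * (n - 1)) * frob k (c i) * frob j (tnth W i)
    = \det M *+ (k == j).
Proof.
(* The relation for column [j - k] modulo [n] is raised to the power [q ^ k], as [frob n] is the
   identity; adding [n] keeps the subtraction from truncating. *)
have m_lt : ((j + n - k) %% n < n)%N by rewrite ltn_mod.
have le_k : (k <= j + n)%N by rewrite (leq_trans (ltnW (ltn_ord k))) ?leq_addl.
have frob_shift (x : L) : frob k (frob ((j + n - k) %% n) x) = frob j x.
  rewrite frob_frob.
  have [lt_jk|le_kj] := ltnP j k.
    rewrite modn_small ?subnK //; last by rewrite ltn_subLR // ltn_add2r.
    by rewrite addnC -frob_frob -[X in frob X x]dimL frob_dim.
  rewrite -addnBAC // modnDr modn_small ?subnK //.
  by rewrite (leq_ltn_trans (leq_subr _ _)).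
under eq_bigr => i _ do rewrite -frob_shift -mulrA -rmorphM.
rewrite -mulr_sumr -rmorph_sum (sum_moore_cofactor (Ordinal m_lt)) rmorphMn /=.
rewrite frob_exp_moore_det mulrnAr mulrA -expr2 sqrr_sign mul1r /=.
congr (_ *+ nat_of_bool _).
rewrite -[_ == 0]/(n %| _)%N -eqn_mod_dvd // modnDr !modn_small //.
by rewrite -val_eqE eq_sym.
Qed.

Lemma trace_moore_cofactor (i j : 'I_n) :
  \sum_(k < n) (-1) ^+ (k * (n - 1)) * frob k (c i) * frob k (tnth W j)
    = \det M *+ (i == j).
Proof.
pose N : 'M[L]_n :=
  \matrix_(k, i) ((\det M)^-1 * ((-1) ^+ (k * (n - 1)) * frob k (c i))).
have NM : N *m M = 1%:M.
  apply/matrixP=> k l; rewrite !mxE.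
  under eq_bigr => m _ do rewrite !mxE -mulrA.
  by rewrite -mulr_sumr sum_frob_moore_cofactor mulrnAr mulVf ?moore_det_neq0.
have := congr1 (fun A : 'M_n => \det M * A j i) (mulmx1C NM).
rewrite !mxE eq_sym mulrnAr mulr1 mulr_sumr => <-; apply: eq_bigr => k _.
by rewrite !mxE [RHS]mulrCA mulVKf ?moore_det_neq0 // mulrC.
Qed.

Lemma Tpoly_lincomb (x : 'rV[F]_n) (i : 'I_n) : lincomb W x != 0 ->
  (Tpoly W n_gt0 i).[lincomb W x ^+ (q - 1)]
    = \det M / lincomb W x * (x 0 i)%:A.
Proof.
move=> y0; apply: (mulIf y0); rewrite mulrAC divfK // horner_sum mulr_suml.
set y := lincomb W x in y0 *.
(* Expanding [y] in the basis [W] reduces this to the duality relation [trace_moore_cofactor], which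
   retains only coordinate [i]. *)
have <- : \sum_(k < n) (-1) ^+ (k * (n - 1)) * frob k (c i) * frob k y
    = \det M * (x 0 i)%:A.
  under eq_bigr => k _ do rewrite frob_lincomb mulr_sumr.
  rewrite exchange_big /= (eq_bigr (fun j => x 0 j *: (\det M *+ (i == j)))).
    rewrite (bigD1 i) //= big1 ?addr0 => [|j nji].
      by rewrite eqxx mulr1n mulr_algr.
    by rewrite eq_sym (negPf nji) scaler0.
  move=> j _; rewrite -trace_moore_cofactor scaler_sumr.
  by apply: eq_bigr => k _; rewrite scalerAr.
apply: eq_bigr => k _.
rewrite hornerZ hornerXn -exprM [((q - 1) * _)%N]mulnC divnK; last first.
  by rewrite !subn1 dvdn_pred_predX.
rewrite -!mulrA -exprSr [(_ ^ _ - 1)%N]subn1 prednK // expn_gt0.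
by rewrite (ltnW (finNzRing_gt1 F)).
Qed.

Lemma Tpoly_const (i : 'I_n) : (Tpoly W n_gt0 i).[0] = c i.
Proof.
have q1 := finNzRing_gt1 F.
rewrite horner_sum (bigD1 (Ordinal n_gt0)) //= big1 ?addr0 => [|k nk0].
  by rewrite hornerZ hornerXn mul0n expn0 subnn div0n !expr0 mul1r expr1 mulr1.
(* For [k > 0] the exponent is positive because [q - 1 <= q ^ k - 1]. *)
rewrite hornerZ hornerXn expr0n gtn_eqF ?mulr0 // divn_gt0 ?subn_gt0 //.
rewrite leq_sub2r // -[leqLHS]expn1 leq_exp2l // lt0n.
by move: nk0; rewrite -val_eqE.
Qed.

End Moore.

(** * Bijectivity of [psi] and normalized homogeneous coordinates *)

Section PsiBijective.
Variables (F : finFieldType) (L : fieldExtType F) (n : nat) (W : n.-tuple L).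
Hypothesis dimL : \dim {:L} = n.
Hypothesis basisW : basis_of fullv W.
Local Notation q := #|F|.
Local Notation psi := (psi basisW).

Lemma val_psi (x : nzvec F n) :
  val (psi (\pi_(PG F n)%qT x)) = lincomb W (val x) ^+ (q - 1).
Proof.
rewrite /Defs.psi -lock /=.
(* The canonical representative is [x] scaled by a nonzero [l] in [F], and [l ^+ (q - 1) = 1]. *)
have /eqmodP/existsP[l /andP[l0 /eqP ->]] :
    (generic_quotient.repr (\pi_(PG F n)%qT x) = x %[mod PG F n])%qT.
  by rewrite reprK.
by rewrite lincombZ exprZn expf_card_pred // scale1r.
Qed.

Lemma psi_inj : injective psi.
Proof.
move=> u v; elim/quotW: u => x; elim/quotW: v => y /(congr1 val).
rewrite !val_psi => exy; apply/eqmodP/existsP.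
have x0 := lincomb_neq0 basisW x; have y0 := lincomb_neq0 basisW y.
have [l xly] : exists l : F, lincomb W (val x) / lincomb W (val y) = l *: 1.
  apply: frob_fixed; rewrite /frob expn1 expr_card_pred exprMn exprVn exy.
  by rewrite mulfV ?mul1r // expf_neq0.
have {}xly : lincomb W (val x) = l *: lincomb W (val y).
  by rewrite -[LHS](divfK y0) xly mulr_algl.
exists l; apply/andP; split; last first.
  by apply/eqP/(lincomb_inj basisW); rewrite lincombZ.
by apply: contraNneq x0 => l0; rewrite xly l0 scale0r.
Qed.

(** Surjectivity at the level of vectors, which serves both the bijection and the exhaustiveness of
    the cases. *)
Lemma exists_psi_vec (z : mu L (mu_exponent F n)) :
  exists x : nzvec F n, val z = lincomb W (val x) ^+ (q - 1).
Proof.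
have [|y y0 zy] := @unity_root_expn_card_pred F L (val z).
  by rewrite dimL; exact: valP z.
have [x yx] := lincombP basisW y.
have x0 : x != 0.
  apply: contraNneq y0 => x0; rewrite yx x0 -(scale0r 0) lincombZ.
  by rewrite scale0r.
by exists (exist _ x x0); rewrite zy yx.
Qed.

Lemma psi_bij : bijective psi.
Proof.
have psi_surj z : exists u, psi u == z.
  have [x zx] := exists_psi_vec z.
  by exists (\pi_(PG F n)%qT x); apply/eqP/val_inj; rewrite val_psi.
pose g z := xchoose (psi_surj z).
have gK : cancel g psi by move=> z; exact/eqP/(xchooseP (psi_surj z)).
by exists g => // u; apply: psi_inj; rewrite gK.
Qed.

(** The representative of a projective point whose last nonzero coordinate, at [j], is scaled to
    1. *)
Definition monic_row (j : 'I_n) (a : 'I_n -> F) : 'rV[F]_n :=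
  \row_i (if (i < j)%N then a i else (i == j)%:R).

Lemma monic_row_neq0 j a : monic_row j a != 0.
Proof.
apply/eqP=> /rowP/(_ j); rewrite !mxE ltnn eqxx => /eqP.
by rewrite oner_eq0.
Qed.

Lemma lincomb_monic_row j a :
  lincomb W (monic_row j a)
    = \sum_(i < n | (i < j)%N) a i *: tnth W i + tnth W j.
Proof.
rewrite /lincomb (bigID (fun i : 'I_n => (i < j)%N)) /=; congr (_ + _).
  by apply: eq_bigr => i lt_ij; rewrite mxE lt_ij.
rewrite (bigD1 j) ?ltnn //= big1 ?addr0 => [|i /andP[/negPf le_ji /negPf nij]].
  by rewrite mxE ltnn eqxx scale1r.
by rewrite mxE le_ji nij scale0r.
Qed.

Lemma exists_monic_row (x : 'rV[F]_n) : x != 0 ->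
  exists j a, exists2 l : F, l != 0 & x = l *: monic_row j a.
Proof.
move=> x0; have /existsP[i0 xi0] : [exists i, x 0 i != 0].
  apply: contraR x0 => /existsPn x0; apply/eqP/rowP=> i; rewrite mxE.
  exact/eqP/negPn/x0.
(* [j] is the last index with a nonzero coordinate, and [x 0 j] is the scaling factor. *)
case: (@arg_maxnP _ i0 (fun i => x 0 i != 0) val xi0) => j xj max_j.
exists j, (fun i => (x 0 j)^-1 * x 0 i), (x 0 j) => //.
apply/rowP=> i; rewrite !mxE; case: ltnP => [_|le_ji]; first by rewrite mulVKf.
case: eqP => [->|/eqP nij]; rewrite ?mulr1 ?mulr0 //.
apply: contraNeq nij => xi; rewrite -val_eqE eqn_leq le_ji andbT.
exact: max_j.
Qed.

End PsiBijective.

Theorem theoremI (F : finFieldType) (n : nat) (n_ge2 : (2 <= n)%N)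
    (L : fieldExtType F) (dimL : \dim {:L} = n)
    (W : n.-tuple L) (basisW : basis_of fullv W) :
  let q := #|F| in
  let T := Tpoly W (ltnW n_ge2) in
  [/\ (* psi_W is well defined, by either of the two formulas *)
      forall x : nzvec F n,
        [/\ val (psi basisW (\pi_(PG F n)%qT x))
              = (\sum_(j < n) val x 0 j *: tnth W j) ^+ (q - 1),
            \sum_(j < n) val x 0 j *: tnth W j != 0
          & val (psi basisW (\pi_(PG F n)%qT x))
              = (\sum_(j < n) val x 0 j *: tnth W j ^+ q)
                  / (\sum_(j < n) val x 0 j *: tnth W j)],
      bijective (psi basisW),
      forall i : 'I_n, (T i).[0] = moore_cofactor W (ltnW n_ge2) i,
      (* the cases in the description of the inverse are exhaustive *)
      forall x : mu L (mu_exponent F n),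
        exists (j : 'I_n) (a : 'I_n -> F),
          val x = (\sum_(i < n | (i < j)%N) a i *: tnth W i + tnth W j)
                    ^+ (q - 1)
    & forall psi_inv : mu L (mu_exponent F n) -> PG F n,
        cancel (psi basisW) psi_inv -> cancel psi_inv (psi basisW) ->
      forall (x : mu L (mu_exponent F n)) (j : 'I_n),
        (exists a : 'I_n -> F,
          val x = (\sum_(i < n | (i < j)%N) a i *: tnth W i + tnth W j)
                    ^+ (q - 1)) ->
        (T j).[val x] != 0 /\
        (* the coordinates of y, embedded into L, are the displayed ones *)
        exists y : nzvec F n,
          map_mx (in_alg L) (val y)
            = \row_(i < n) (if (i < j)%N then (T i).[val x] / (T j).[val x]
                            else if i == j then 1 else 0)
          /\ psi_inv x = \pi_(PG F n)%qT y].
Proof.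
move=> q T; split.
- move=> x; have y0 := lincomb_neq0 basisW x.
  split=> //; first exact: val_psi.
  rewrite val_psi; apply: (mulIf y0); rewrite -expr_card_pred divfK //.
  (* The second formula holds because the [q]-th power map is [F]-linear. *)
  by have := frob_lincomb W 1 (val x); rewrite /frob expn1 => ->.
- exact: psi_bij.
- exact: Tpoly_const.
- move=> z; have [x ->] := exists_psi_vec dimL basisW z.
  have [j [a [l l0 ->]]] := exists_monic_row (valP x); exists j, a.
  by rewrite -lincomb_monic_row lincombZ exprZn expf_card_pred // scale1r.
move=> psi_inv psiK _ x j [a]; rewrite -lincomb_monic_row => xa.
pose y : nzvec F n := exist _ (monic_row j a) (monic_row_neq0 j a).
have y0 : lincomb W (monic_row j a) != 0 := lincomb_neq0 basisW y.
have TE i : (T i).[val x]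
    = \det (moore_mx W) / lincomb W (monic_row j a) * (monic_row j a 0 i)%:A.
  by rewrite xa Tpoly_lincomb.
(* Coordinate [j] is 1, so the value of [T j] is the common factor itself; dividing by it recovers
   the other coordinates. *)
have Tj : (T j).[val x] = \det (moore_mx W) / lincomb W (monic_row j a).
  by rewrite TE mxE ltnn eqxx scale1r mulr1.
have Tj0 : (T j).[val x] != 0.
  by rewrite Tj mulf_neq0 ?invr_eq0 // moore_det_neq0.
split=> //; exists y; split.
  apply/rowP=> i; rewrite !mxE; case: ifP => [lt_ij|_].
    by rewrite TE -Tj mulrAC mulfV // mul1r mxE lt_ij.
  by case: eqP; rewrite ?rmorph1 ?rmorph0.
rewrite -[RHS]psiK; congr psi_inv; apply: val_inj.
by rewrite val_psi.
Qed.
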